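(* For every integer $d \ge 4$, we have $e^*_{\mathrm{irr}}(d) \ge \frac{d}{2} - \frac{1}{4}$.
   Context: For a polynomial $P(x)$ with integer coefficients, its (naive) height $H(P)$ is the maximum of the absolute values of its coefficients. For a separable integer polynomial $P(x)$ of degree $d \ge 2$ with distinct complex roots $\alpha_1,\dots,\alpha_d$, set $\mathrm{sep}(P) = \min_{1\le i<j\le d} |\alpha_i - \alpha_j|$, and define the real number $e(P)$ by $\mathrm{sep}(P) = H(P)^{-e(P)}$. For $d \ge 2$, let $e^*_{\mathrm{irr}}(d) = \limsup e(P)$, where the limsup is taken over all monic integer polynomials $P(x)$ of degree $d$ that are irreducible over $\mathbb{Q}$, as $H(P) \to +\infty$. *)

(* Defs.v *)
From HB Require Import structures.
From mathcomp Require Import all_boot all_order all_algebra separable complex.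
From mathcomp Require Import all_classical all_reals all_analysis.

Set Implicit Arguments.
Unset Strict Implicit.
Unset Printing Implicit Defensive.

Import Order.TTheory GRing.Theory Num.Theory.
Import ComplexField.Normc.

Local Open Scope classical_set_scope.
Local Open Scope ring_scope.
Local Open Scope complex_scope.

Definition height (P : {poly int}) : nat := \max_(i < size P) absz (P`_i)%R.

Definition croot (R : realType) (P : {poly int}) (z : R[i]) : Prop :=
  root (map_poly intr P) z.

(* For separable P of degree at least 2 this set is finite and nonempty, so
   that its infimum is a minimum; see sep_min below. *)
Definition sep (R : realType) (P : {poly int}) : R :=
  inf [set r : R | exists z w : R[i],
         [/\ croot P z, croot P w, z != w & r = normc (z - w)]].

(* The solution e of sep P = (height P) ^ (- e); see sep_powR below. When
   height P <= 1 no such e exists in general, and the value is junk. *)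
Definition sep_exponent (R : realType) (P : {poly int}) : R :=
  - ln (sep R P) / ln (height P)%:R.

Definition monic_irreducible (d : nat) : set {poly int} :=
  [set P | [/\ P \is monic, size P = d.+1 &
              irreducible_poly (map_poly intr P : {poly rat})]].

Definition e_irr_star (R : realType) (d : nat) : \bar R :=
  ereal_inf (range (fun N : nat =>
    ereal_sup [set (sep_exponent R P)%:E | P in
      [set P | monic_irreducible d P /\ (N <= height P)%N]])).

Lemma sep_min (R : realType) (P : {poly int}) :
    separable_poly (map_poly intr P : {poly rat}) -> (2 < size P)%N ->
  (exists z w : R[i],
     [/\ croot P z, croot P w, z != w & sep R P = normc (z - w)])
  /\ (forall z w : R[i], croot P z -> croot P w -> z != w ->
        sep R P <= normc (z - w)).
Proof.
move=> sepP szP.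
set p : {poly R[i]} := map_poly intr P.
have szp : size p = size P.
  by rewrite size_map_inj_poly ?rmorph0 //; exact: intr_inj.
have p0 : p != 0 by rewrite -size_poly_gt0 szp (leq_trans _ szP).
have sp : separable_poly p.
  have -> : p = map_poly ratr (map_poly intr P : {poly rat}).
    by rewrite -map_poly_comp; apply: eq_map_poly => x /=; rewrite ratr_int.
  by rewrite separable_map.
have [rs prs] := closed_field_poly_normal p.
have l0 : lead_coef p != 0 by rewrite lead_coef_eq0.
have rrs z : root p z = (z \in rs) by rewrite prs rootZ// root_prod_XsubC.
have urs : uniq rs.
  rewrite -separable_prod_XsubC.
  move: sp; rewrite unlock {1 2}prs derivZ.
  by rewrite coprimepZl// coprimepZr.
have srs : (1 < size rs)%N.
  by move: szp szP; rewrite prs size_scale// size_prod_XsubC => <-.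
set S := [set r : R | exists z w : R[i],
         [/\ croot P z, croot P w, z != w & r = normc (z - w)]].
have normc_ge0 (z : R[i]) : 0 <= normc z by case: z => a b /=; exact: sqrtr_ge0.
have Slb : has_lbound S by exists 0 => _ [z [w [_ _ _ ->]]].
have sepS : forall z w : R[i], croot P z -> croot P w -> z != w ->
    sep R P <= normc (z - w).
  by move=> z w rz rw zw; apply: (ge_inf Slb); exists z, w.
split=> //.
pose s := [seq x <- [seq (z, w) | z <- rs, w <- rs] | x.1 != x.2].
have ms z w : ((z, w) \in s) = [&& z != w, z \in rs & w \in rs].
  rewrite mem_filter; congr (_ && _).
  apply/allpairsP/andP => [[[a b] /= [? ? [-> ->]]]//|[zr wr]].
  by exists (z, w).
have [x0 x0s] : exists x0, x0 \in s.
  move: urs srs ms; case: (rs) => [|z [|w l]]//= /andP[zl _] _ ms.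
  exists (z, w); rewrite ms !inE !eqxx orbT /= andbT.
  by apply: contraNneq zl => ->; rewrite inE eqxx.
have [[z w] zws zwm] : exists2 x, x \in s &
    forall y, y \in s -> normc (x.1 - x.2) <= normc (y.1 - y.2).
  elim: (s) x0 x0s => // x l IH _ _.
  case: l IH => [_|y l IH].
    by exists x; rewrite ?mem_head// => y; rewrite inE => /eqP->.
  have [|x' x'l x'm] := IH y; first exact: mem_head.
  have [le|/ltW le] := leP (normc (x.1 - x.2)) (normc (x'.1 - x'.2)).
    exists x; first exact: mem_head.
    by move=> t; rewrite inE => /predU1P[->//|/x'm]; exact: le_trans.
  exists x'; first by rewrite inE x'l orbT.
  by move=> t; rewrite inE => /predU1P[->//|/x'm].
move: (zws); rewrite ms => /and3P[zw zr wr].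
exists z, w; split; rewrite /croot ?rrs//.
apply/le_anti/andP; split; first by apply: sepS; rewrite /croot ?rrs.
apply: lb_le_inf; first by exists (normc (z - w)), z, w; rewrite /croot !rrs.
move=> _ [a [b [ra rb ab ->]]]; apply: (zwm (a, b)).
by rewrite ms ab -!rrs ra rb.
Qed.

Lemma sep_powR (R : realType) (P : {poly int}) :
    separable_poly (map_poly intr P : {poly rat}) -> (2 < size P)%N ->
    (1 < height P)%N ->
  sep R P = (height P)%:R `^ (- sep_exponent R P).
Proof.
move=> sepP szP HP.
have [[z [w [_ _ zw E]]] _] := sep_min R sepP szP.
have sep0 : 0 < sep R P.
  rewrite lt_neqAle E; apply/andP; split; last first.
    by case: (z - w) => a b /=; exact: sqrtr_ge0.
  by rewrite eq_sym; apply: contra zw => /eqP/eq0_normc/eqP; rewrite subr_eq0.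
have H1 : 1 < (height P)%:R :> R by rewrite ltr1n.
rewrite /powR gt_eqF ?(lt_trans ltr01)// /sep_exponent !mulNr opprK.
by rewrite divfK ?lnK// gt_eqF ?ln_gt0.
Qed.

(* Main.v *)
Require Import Defs.
From mathcomp Require Import all_boot all_order all_algebra.
From mathcomp Require Import all_classical all_reals all_analysis.
From mathcomp Require Import algC separable complex polyorder ring lra zify.

(** With [a = b^2], consider monic polynomials [P = U^2 + X V^2] of degree [d]
    and height of order [a^2], where [U] is nearly [a X + 1] close to [-1/a] and
    [V] has size [|x|^(d-2)] at the zero [x < 0] of [U] near [-1/a]. There
    [P(x) = x V(x)^2 < 0], whereas [U^2] exceeds [|X| V^2] as soon as one moves
    away from [x] by a constant times [a^(1/2-d)]; hence [P] has two real roots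
    at distance [O(a^(1/2-d))], that is [O(H(P)^(1/4-d/2))]. All coefficients of
    [P] are nonnegative and the coefficient of [X^(d-1)] exceeds the sum of all
    others, so [P] is irreducible by Perron's criterion: exactly one complex root
    has modulus at least 1, and an integer factor avoiding it would have a
    constant term of modulus less than 1. *)

Set Implicit Arguments.
Unset Strict Implicit.
Unset Printing Implicit Defensive.

Import Order.TTheory GRing.Theory Num.Theory.
Import ComplexField.Normc.

Local Open Scope ring_scope.
Local Open Scope complex_scope.

(** * Perron's irreducibility criterion *)

(** The coefficients of the product are [Q_(i-1) - x * Q_i]. Bounding each below by the reverse
    triangle inequality and summing turns the hypothesis into [0 < (|x| - 1) * (1 - S)], with [S]
    the sum to be bounded. *)
Lemma perron_quotient (F : numFieldType) (n : nat) (Q : {poly F}) (x : F) :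
    Q \is monic -> size Q = n.+1 -> 1 <= `|x| ->
    1 + \sum_(i < n) `|(('X - x%:P) * Q)`_i| < `|(('X - x%:P) * Q)`_n| ->
  \sum_(i < n) `|Q`_i| < 1.
Proof.
move=> mQ szQ x1; case: n szQ => [|m] szQ; first by move=> _; rewrite big_ord0 ltr01.
have cP i : (('X - x%:P) * Q)`_i = (if i == 0%N then 0 else Q`_i.-1) - x * Q`_i.
  by rewrite mulrBl coefB coefXM coefCM.
have Qm : Q`_m.+1 = 1 by move/monicP: mQ; rewrite lead_coefE szQ.
rewrite big_ord_recl !cP /= Qm mulr1 sub0r normrN normrM.
set S := \sum_(i < m.+1) `|Q`_i|.
have S1 : S = `|Q`_0| + \sum_(i < m) `|Q`_i.+1| by rewrite /S big_ord_recl.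
have S2 : S = \sum_(i < m) `|Q`_i| + `|Q`_m| by rewrite /S big_ord_recr.
set T := \sum_(i < m) _ => lt1.
have leT : `|x| * \sum_(i < m) `|Q`_i.+1| - \sum_(i < m) `|Q`_i| <= T.
  rewrite mulr_sumr -sumrB; apply: ler_sum => i _.
  by rewrite cP /= -normrM distrC; apply: lerB_dist.
have lt2 : 1 + (`|x| * `|Q`_0| + (`|x| * \sum_(i < m) `|Q`_i.+1|
             - \sum_(i < m) `|Q`_i|)) < `|Q`_m| + `|x|.
  apply: le_lt_trans (lt_le_trans lt1 (ler_normB _ _)).
  by rewrite lerD2l lerD2l.
have lt3 : 0 < (`|x| - 1) * (1 - S).
  move: lt2; rewrite -subr_gt0; congr (0 < _).
  have -> : \sum_(i < m) `|Q`_i.+1| = S - `|Q`_0| by rewrite S1 addrC addKr.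
  have -> : \sum_(i < m) `|Q`_i| = S - `|Q`_m| by rewrite S2 addrK.
  by ring.
have x1' : 0 < `|x| - 1.
  rewrite lt_neqAle subr_ge0 x1 andbT eq_sym.
  by apply: contraTneq lt3 => ->; rewrite mul0r ltxx.
by rewrite -subr_gt0 -(pmulr_rgt0 _ x1').
Qed.

(** At a root with [|z| >= 1], the leading term would give [|z|^n <= S * |z|^n] with [S < 1]. *)
Lemma norm_root_lt1 (F : numFieldType) (n : nat) (Q : {poly F}) (z : F) :
    Q \is monic -> size Q = n.+1 -> \sum_(i < n) `|Q`_i| < 1 ->
  root Q z -> `|z| < 1.
Proof.
move=> mQ szQ S1 /rootP; rewrite horner_coef szQ big_ord_recr /=.
have -> : Q`_n = 1 by move/monicP: mQ; rewrite lead_coefE szQ.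
rewrite mul1r addrC => /eqP; rewrite addr_eq0 => /eqP zn.
rewrite real_ltNge ?real1 ?normr_real //; apply/negP => z1.
have zn0 : 0 < `|z| ^+ n by rewrite exprn_gt0 ?(lt_le_trans ltr01).
have : `|z| ^+ n <= (\sum_(i < n) `|Q`_i|) * `|z| ^+ n.
  rewrite -{1}normrX zn normrN (le_trans (ler_norm_sum _ _ _)) //.
  rewrite mulr_suml; apply: ler_sum => i _; rewrite normrM normrX.
  by rewrite ler_wpM2l // ler_weXn2l // ltnW.
by rewrite ler_pMl // real_leNgt ?S1 // ?real1 // ger0_real // sumr_ge0.
Qed.

(** The product of the roots has modulus [|g_0|], which is at least 1 for a nonzero integer, so the
    roots cannot all lie in the open unit disc. *)
Lemma exists_root_norm_ge1 (C : numClosedFieldType) (g : {poly int}) :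
    `|lead_coef g| = 1 -> (1 < size g)%N -> g`_0 != 0 ->
  exists2 z : C, root (map_poly intr g) z & 1 <= `|z|.
Proof.
move=> lg sg g0; set p : {poly C} := map_poly intr g.
have [rs prs] := closed_field_poly_normal p.
have lp : `|lead_coef p| = 1.
  by rewrite lead_coef_map_inj ?rmorph0 //; [rewrite -intr_norm lg|exact: intr_inj].
have szp : size p = size g.
  by rewrite size_map_inj_poly ?rmorph0 //; exact: intr_inj.
have lp0 : lead_coef p != 0 by rewrite -normr_eq0 lp oner_eq0.
have srs : (0 < size rs)%N.
  by move: sg; rewrite -szp prs size_scale // size_prod_XsubC.
case: (boolP (has (fun z => 1 <= `|z|) rs)) => [/hasP[z zr z1]|/hasPn zs].
  by exists z => //; rewrite prs rootZ // root_prod_XsubC.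
have : 1 <= `|p`_0|.
  by rewrite coef_map /= -intr_norm -[1]/(1%:~R) ler_int -gtz0_ge1 normr_gt0.
rewrite -horner_coef0 prs hornerZ normrM lp mul1r horner_prod normr_prod.
have {}zs z : z \in rs -> `|z| < 1.
  by move=> /zs; rewrite -real_ltNge ?real1 ?normr_real.
case: rs srs zs {prs} => // z rs _ zs.
rewrite big_cons hornerXsubC sub0r normrN real_leNgt ?real1 ?ger0_real //; last first.
  by rewrite mulr_ge0 // prodr_ge0.
case/negP; apply: le_lt_trans (zs z (mem_head _ _)).
apply: ler_piMr => //; rewrite big_seq; apply: prodr_ile1 => t tr.
by rewrite normr_ge0 hornerXsubC sub0r normrN ltW // zs // inE tr orbT.
Qed.

Theorem perron_irreducible (d : nat) (P : {poly int}) :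
    P \is monic -> size P = d.+2 -> P`_0 != 0 ->
    1 + \sum_(i < d) `|P`_i| < `|P`_d| ->
  irreducible_poly (map_poly intr P : {poly rat}).
Proof.
move=> mP szP P0 HP.
have szm (C : numFieldType) (g : {poly int}) :
    size (map_poly intr g : {poly C}) = size g.
  by rewrite size_map_inj_poly ?rmorph0 //; exact: intr_inj.
have [||x xr x1] := @exists_root_norm_ge1 algC P _ _ P0.
- by rewrite (monicP mP) normr1.
- by rewrite szP.
set p : {poly algC} := map_poly intr P in xr.
have mp : p \is monic by exact: monic_map.
have [Q pQ] : exists Q, p = ('X - x%:P) * Q.
  by have /factor_theorem[Q ->] := xr; exists Q; rewrite mulrC.
have mQ : Q \is monic by rewrite -(monicMl _ (monicXsubC x)) -pQ.
have szQ : size Q = d.+1.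
  have := szm algC P; rewrite -/p pQ size_monicM ?monicXsubC ?monic_neq0 //.
  by rewrite szP size_XsubC /= => -[].
have SQ : \sum_(i < d) `|Q`_i| < 1.
  apply: (perron_quotient mQ szQ x1); rewrite -pQ.
  have -> : \sum_(i < d) `|p`_i| = (\sum_(i < d) `|P`_i|)%:~R.
    by rewrite rmorph_sum /=; apply: eq_bigr => i _; rewrite coef_map /= intr_norm.
  by rewrite coef_map /= -intr_norm -[1]/(1%:~R) -intrD ltr_int.
(* When [f] takes the root [x], the cofactor [g] divides [Q], so all its roots lie in the open unit
   disc and [g] must be constant. *)
have factor (f g : {poly int}) : P = f * g -> `|lead_coef g| = 1 ->
    root (map_poly intr f : {poly algC}) x -> (size g <= 1)%N.
  move=> Pfg lg fx; rewrite leqNgt; apply/negP => sg.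
  have [|z gz z1] := @exists_root_norm_ge1 algC g lg sg.
    by apply: contraNneq P0 => g0; rewrite Pfg coef0M g0 mulr0.
  have /factor_theorem[h fh] := fx.
  have Qhg : Q = h * map_poly intr g.
    apply: (mulfI (monic_neq0 (monicXsubC x))).
    by rewrite -pQ /p Pfg rmorphM /= fh mulrA (mulrC _ h).
  have := norm_root_lt1 mQ szQ SQ (_ : root Q z).
  rewrite Qhg rootM gz orbT => /(_ isT).
  by rewrite real_ltNge ?z1 // ?real1 ?normr_real.
split=> [|q sq]; first by rewrite szm szP.
(* Gauss's lemma: a rational divisor is a scalar multiple of an integer one. *)
case/dvdpP_rat_int=> f [c c0 qE] [g Pfg].
have lfg : lead_coef f * lead_coef g = 1 by rewrite -lead_coefM -Pfg (monicP mP).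
have [lf lg] : `|lead_coef f| = 1 /\ `|lead_coef g| = 1.
  have : (`|lead_coef f| * `|lead_coef g|)%N = 1%N by rewrite -abszM lfg.
  by move/eqP; rewrite muln_eq1 => /andP[/eqP e1 /eqP e2]; rewrite -!abszE e1 e2.
move: sq; rewrite qE size_scale // szm => sf.
apply/(eqp_trans (eqp_scale _ c0)).
have sg : (size g <= 1)%N.
  (* If [x] is a root of [g] instead, the roles are exchanged and [f] has size at most 1, against
     [sf] and the unit leading coefficient. *)
  move: xr; rewrite /p Pfg rmorphM rootM => /orP[|gx]; first exact: factor.
  have := factor g f; rewrite mulrC => /(_ Pfg lf gx).
  rewrite leq_eqVlt (negPf sf) /= ltnS leqn0 size_poly_eq0 => /eqP f0.
  by move: lf; rewrite f0 lead_coef0 normr0.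
rewrite Pfg [g]size1_polyC // rmorphM /= map_polyC /= mulrC mul_polyC eqp_sym eqp_scale //.
rewrite intr_eq0; apply/eqP => g0; move: lg.
by rewrite [g]size1_polyC // g0 lead_coef0 normr0.
Qed.

(** * Two close real roots *)

(** Here [e] is the degree minus 2. Bounds are asked only up to [4 / b^2]: the zero [s] of [U] is
    within [2 / b^2] of 0, and the points [s - h] and [s + h] where positivity is tested are at most
    [2 / b^2] further. *)
Lemma close_roots (R : rcfType) (e : nat) (b : R) (U V : {poly R}) :
    2 ^+ (e + 7) <= b -> U.[0] = 1 ->
    (forall x y : R, `|x| <= 4 / b ^+ 2 -> `|y| <= 4 / b ^+ 2 -> y <= x ->
      b ^+ 2 / 2 * (x - y) <= U.[x] - U.[y]) ->
    (forall x y : R, `|x| <= 4 / b ^+ 2 -> `|y| <= 4 / b ^+ 2 ->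
      `|V.[x] - V.[y]| <= 8 * b ^+ 2 * `|x - y|) ->
    (forall x : R, `|x| <= 4 / b ^+ 2 -> x != 0 -> U.[x] = 0 ->
      V.[x] != 0 /\ `|V.[x]| <= 8 * `|x| ^+ e) ->
  exists x y, [/\ root (U ^+ 2 + 'X * V ^+ 2) x, root (U ^+ 2 + 'X * V ^+ 2) y,
    x < y & y - x <= 2 ^+ (e + 7) / b ^+ (2 * e + 3)].
Proof.
set M : R := 2 ^+ (e + 3) => bM U0 slopeU lipV Vroot.
have M8 : 8 <= M.
  have -> : 8 = 2 ^+ 3 :> R by ring.
  by rewrite /M ler_weXn2l ?leq_addl // ler1n.
have b8 : 16 * M <= b.
  suff -> : 16 * M = 2 ^+ (e + 7) by [].
  by rewrite /M !exprD; ring.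
have M0 : 0 < M by lra.
have b0 : 0 < b by lra.
have b64 : 64 < b by lra.
have b64_ge0 : 0 <= 2 * (b + 64) by lra.
have b4_ge0 : 0 <= 4 * b by lra.
have Mb_ge0 : 0 <= M * b + 64 * M by nra.
set a := b ^+ 2 in slopeU lipV Vroot *.
have a0 : 0 < a by rewrite exprn_gt0.
have ai0 : 0 < a^-1 by rewrite invr_gt0.
(* Since [U(0) = 1] and the slope is at least [a / 2], [U] is nonpositive at [- 2 / a]. *)
have [s /andP[s1 s2] /rootP Us] :
    exists2 s : R, - (2 / a) <= s <= 0 & root U s.
  apply: poly_ivt; first by rewrite oppr_le0 divr_ge0 // ltW.
  rewrite U0 ler01 andbT.
  have := slopeU 0 (- (2 / a)); rewrite U0 normr0 normrN sub0r opprK.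
  rewrite ger0_norm ?divr_ge0 ?(ltW a0) //.
  have -> : a / 2 * (2 / a) = 1 by field; rewrite gt_eqF.
  move=> H; suff : 1 <= 1 - U.[- (2 / a)] by lra.
  by apply: H; nra.
have s0 : s < 0.
  by rewrite lt_neqAle s2 andbT; apply: contra_eq_neq Us => ->; rewrite U0 oner_neq0.
have ns : `|s| <= 2 / a by rewrite ltr0_norm //; lra.
have [|Vs0 Vs] := Vroot s _ (ltr0_neq0 s0) Us; first by nra.
set q := (a ^+ e.+1)^-1.
have q0 : 0 < q by rewrite invr_gt0 exprn_gt0.
have {}Vs : `|V.[s]| <= M * b ^+ 2 * q.
  apply: le_trans Vs _.
  have -> : M * b ^+ 2 * q = 8 * (2 / a) ^+ e.
    rewrite -/a /M /q exprD expr_div_n (exprS a); field.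
    by rewrite !gt_eqF // exprn_gt0.
  by rewrite ler_wpM2l // lerXn2r // nnegrE ?normr_ge0 // divr_ge0 // ltW.
set h := 8 * M * b * q / a.
have h0 : 0 < h by rewrite !mulr_gt0.
have hle : h <= 2 / a.
  rewrite /h ler_pM2r // /q.
  rewrite ler_pdivrMr ?exprn_gt0 //.
  have : a <= a ^+ e.+1 by rewrite ler_eXnr //; rewrite /a; nra.
  have : 8 * M * b <= a by rewrite /a expr2 ler_pM2r //; lra.
  by nra.
have ah : a * h = 8 * M * b * q by rewrite /h; field; rewrite gt_eqF.
(* U grows like a h / 2 while sqrt |t| * V stays below it: this is what
   dictates the size of h. *)
have pos t : `|t - s| = h -> 0 < (U ^+ 2 + 'X * V ^+ 2).[t].
  move=> ts; rewrite hornerD horner_exp hornerM horner_exp hornerX.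
  have nt : `|t| <= 4 / a.
    have := ler_normD (t - s) s; rewrite subrK ts; lra.
  have ns' : `|s| <= 4 / a by nra.
  have Ut : 4 * M * b * q <= `|U.[t]|.
    have -> : 4 * M * b * q = a / 2 * `|t - s| by rewrite ts; nra.
    have [le|/ltW le] := leP s t.
      have := slopeU t s nt ns' le; rewrite Us subr0 ger0_norm ?subr_ge0 //.
      by move=> /le_trans; apply; exact: ler_norm.
    have := slopeU s t ns' nt le; rewrite Us sub0r ler0_norm ?subr_le0 // opprB.
    by move=> /le_trans; apply; rewrite -normrN; exact: ler_norm.
  have Vt : `|V.[t]| <= (M * b + 64 * M) * (b * q).
    have := lipV t s nt ns'; rewrite ts -mulrA ah => H.
    have := ler_normD (V.[t] - V.[s]) V.[s]; rewrite subrK => H'.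
    apply: (le_trans H'); apply: le_trans (lerD H Vs) _.
    by rewrite le_eqVlt; apply/orP; left; apply/eqP; ring.
  have Ut2 : (4 * M * b * q) ^+ 2 <= U.[t] ^+ 2.
    rewrite -[U.[t] ^+ 2]real_normK ?num_real // lerXn2r // nnegrE ?normr_ge0 //.
    by rewrite !mulr_ge0 // ltW.
  have Vt2 : V.[t] ^+ 2 <= ((M * b + 64 * M) * (b * q)) ^+ 2.
    rewrite -[V.[t] ^+ 2]real_normK ?num_real // lerXn2r // nnegrE ?normr_ge0 //.
    by rewrite mulr_ge0 // mulr_ge0 // ltW.
  have tV : - (4 / a * ((M * b + 64 * M) * (b * q)) ^+ 2) <= t * V.[t] ^+ 2.
    rewrite lerNl -mulNr.
    apply: (@le_trans _ _ (`|t| * V.[t] ^+ 2)).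
      by rewrite ler_wpM2r ?sqr_ge0 // -normrN ler_norm.
    by rewrite ler_pM ?normr_ge0 ?sqr_ge0.
  have E : 4 / a * ((M * b + 64 * M) * (b * q)) ^+ 2 = 4 * ((b + 64) * M * q) ^+ 2.
    by rewrite /a; field; rewrite gt_eqF.
  rewrite E in tV.
  (* After cancelling [M * q], this compares [2 * (b + 64)] with [4 * b], hence the need for
     [b > 64]. *)
  suff : 4 * ((b + 64) * M * q) ^+ 2 < (4 * M * b * q) ^+ 2.
    by move: tV Ut2; clear; lra.
  have -> : 4 * ((b + 64) * M * q) ^+ 2 = (2 * (b + 64) * (M * q)) ^+ 2 by ring.
  have -> : (4 * M * b * q) ^+ 2 = (4 * b * (M * q)) ^+ 2 by ring.
  have Mq : 0 < M * q by rewrite mulr_gt0.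
  rewrite ltr_pXn2r ?nnegrE //; [|exact: mulr_ge0 (ltW Mq)..].
  by rewrite ltr_pM2r //; move: b64; clear; lra.
have neg : (U ^+ 2 + 'X * V ^+ 2).[s] < 0.
  rewrite hornerD horner_exp hornerM horner_exp hornerX Us expr0n add0r.
  by rewrite pmulr_llt0 // lt_neqAle sqr_ge0 andbT eq_sym sqrf_eq0.
(* The sign goes from positive to negative here, whereas [poly_ivt] wants the opposite; hence the
   negated polynomial. *)
have [x /andP[x1 x2] xr] : exists2 x, s - h <= x <= s & root (- (U ^+ 2 + 'X * V ^+ 2)) x.
  apply: poly_ivt; first lra.
  rewrite !hornerN oppr_le0 oppr_ge0 (ltW neg) andbT ltW // pos //.
  by rewrite addrAC subrr add0r normrN gtr0_norm.
have [y /andP[y1 y2] yr] : exists2 y, s <= y <= s + h & root (U ^+ 2 + 'X * V ^+ 2) y.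
  apply: poly_ivt; first lra.
  by rewrite (ltW neg) ltW // pos // addrAC subrr add0r gtr0_norm.
rewrite rootN in xr.
(* The intermediate value theorem only gives [x <= s <= y]; negativity at [s] makes the inequalities
   strict. *)
have neq z : root (U ^+ 2 + 'X * V ^+ 2) z -> z != s.
  by move=> /rootP z0; apply: contraTneq neg => <-; rewrite z0 ltxx.
exists x, y; split=> //.
  have xs : x < s by rewrite lt_neqAle x2 neq.
  by apply: lt_le_trans y1.
(* With [a = b^2] and [M = 2^(e+3)], [2 * h] equals [16 * M * b / a^(e+2)], which is the stated
   bound. *)
apply: (@le_trans _ _ (2 * h)); first lra.
rewrite le_eqVlt; apply/orP; left; apply/eqP.
rewrite /h /q /M /a -exprM mulnS !exprD; field.
by rewrite ?gt_eqF ?exprn_gt0.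
Qed.

(** * The polynomials U and V *)

(** The factor [r] gained over the plain Lipschitz bound 1 is what compensates the large coefficient
    [4 * a + 1] of [oddU]. *)
Lemma normXB_le_small (R : realFieldType) (r x y : R) (m : nat) :
    r <= 1 / 2 -> `|x| <= r -> `|y| <= r ->
  `|x ^+ m.+2 - y ^+ m.+2| <= 2 * r * `|x - y|.
Proof.
move=> r2 xr yr; elim: m => [|m IH].
  rewrite subr_sqr mulrC normrM ler_wpM2r //.
  by apply: le_trans (ler_normD _ _) _; lra.
have -> : x ^+ m.+3 - y ^+ m.+3 = x * (x ^+ m.+2 - y ^+ m.+2) + y ^+ m.+2 * (x - y).
  by rewrite (exprS x m.+2) (exprS y m.+2); ring.
apply: le_trans (ler_normD _ _) _; rewrite (normrM x) (normrM (y ^+ m.+2)) (normrX m.+2).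
have y1 : `|y| ^+ m.+2 <= r.
  apply: le_trans (yr); rewrite exprS ler_piMr // exprn_ile1 //; lra.
have H1 : `|x| * `|x ^+ m.+2 - y ^+ m.+2| <= 1 / 2 * (2 * r * `|x - y|).
  by rewrite ler_pM //; lra.
have H2 : `|y| ^+ m.+2 * `|x - y| <= r * `|x - y| by rewrite ler_wpM2r.
lra.
Qed.

Lemma normXB_le (R : realFieldType) (x y : R) (m : nat) :
    `|x| <= 1 / 2 -> `|y| <= 1 / 2 -> `|x ^+ m - y ^+ m| <= `|x - y|.
Proof.
move=> x2 y2; case: m => [|[|m]]; rewrite ?expr1 ?expr0 ?subrr ?normr0 //.
have := @normXB_le_small R (1 / 2) x y m (lexx _) x2 y2.
by have -> : 2 * (1 / 2) = 1 :> R by [field]; rewrite mul1r.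
Qed.

Lemma horner_intr_CM (R : comNzRingType) (c : int) (q : {poly int}) (x : R) :
  (map_poly intr (c%:P * q)).[x] = c%:~R * (map_poly intr q).[x].
Proof. by rewrite rmorphM /= map_polyC hornerM hornerC. Qed.

Lemma horner_intr_D (R : comNzRingType) (p q : {poly int}) (x : R) :
  (map_poly intr (p + q)).[x] = (map_poly intr p).[x] + (map_poly intr q).[x].
Proof. by rewrite rmorphD hornerD. Qed.

(* The roots of trinom^2 + X * evenV^2 (degree 2m+4) and of
   oddU^2 + X * trinom^2 (degree 2m+5) are studied near -1/a. At a zero of
   trinom one has evenV = - 4 X^(2m+2). Moreover
   oddU = (4 X^(m+1) + 1) * trinom - 4 X^(2m+3), so at a zero of oddU the
   trinomial is comparable to X^(2m+3). The factor 4 makes the second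
   coefficient of the resulting polynomial dominate the others. *)
Definition trinom (m : nat) (a : int) : {poly int} := 'X^(m.+2) + a%:P * 'X + 1.
Definition evenV (m : nat) (a : int) : {poly int} := (4 * a)%:P * 'X^(m.+1) + 4%:P * 'X^m.

Lemma horner_trinom (R : comNzRingType) (m : nat) (a : int) (x : R) :
  (map_poly intr (trinom m a)).[x] = x ^+ m.+2 + a%:~R * x + 1.
Proof.
by rewrite !horner_intr_D horner_intr_CM map_polyXn map_polyX rmorph1 !hornerE.
Qed.

Lemma horner_evenV (R : comNzRingType) (m : nat) (a : int) (x : R) :
  (map_poly intr (evenV m a)).[x] = 4 * (a%:~R * x ^+ m.+1 + x ^+ m).
Proof.
rewrite horner_intr_D !horner_intr_CM !map_polyXn !hornerXn rmorphM /=.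
by rewrite mulrDr mulrA.
Qed.

Definition oddU (m : nat) (a : int) : {poly int} :=
  (4 * a + 1)%:P * 'X^(m.+2) + 4%:P * 'X^(m.+1) + a%:P * 'X + 1.

Lemma horner_oddU (R : comNzRingType) (m : nat) (a : int) (x : R) :
  (map_poly intr (oddU m a)).[x] =
  (4 * a%:~R + 1) * x ^+ m.+2 + 4 * x ^+ m.+1 + a%:~R * x + 1.
Proof.
rewrite !horner_intr_D !horner_intr_CM !map_polyXn map_polyX rmorph1.
by rewrite !hornerXn hornerX hornerC rmorphD rmorphM.
Qed.
Lemma four_div_le (R : realFieldType) (A : R) : 128 <= A -> 4 / A <= 1 / 32.
Proof. by move=> A128; rewrite ler_pdivrMr; lra. Qed.

(** The linear term has slope [A] and the power perturbs it by at most 1. *)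
Lemma trinom_slope (R : realFieldType) (m : nat) (a : int) (A : R) (x y : R) :
    a%:~R = A -> 128 <= A -> `|x| <= 4 / A -> `|y| <= 4 / A -> y <= x ->
  A / 2 * (x - y) <= (map_poly intr (trinom m a)).[x] - (map_poly intr (trinom m a)).[y].
Proof.
move=> aA A128; have r8 := four_div_le A128 => xr yr le_yx.
rewrite !horner_trinom aA; clear aA.
have := @normXB_le R x y m.+2; rewrite [`|x - y|]ger0_norm ?subr_ge0 //.
move=> /(_ (le_trans xr _) (le_trans yr _)); case/(_ _ _)/ler_normlP; [lra..|].
by move=> H _; nra.
Qed.

Lemma evenV_lip (R : realFieldType) (m : nat) (a : int) (A : R) (x y : R) :
    a%:~R = A -> 128 <= A -> `|x| <= 4 / A -> `|y| <= 4 / A ->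
  `|(map_poly intr (evenV m a)).[x] - (map_poly intr (evenV m a)).[y]|
    <= 8 * A * `|x - y|.
Proof.
move=> aA A128; have r8 := four_div_le A128 => xr yr.
rewrite !horner_evenV aA; clear aA.
have -> : 4 * (A * x ^+ m.+1 + x ^+ m) - 4 * (A * y ^+ m.+1 + y ^+ m) =
  4 * A * (x ^+ m.+1 - y ^+ m.+1) + 4 * (x ^+ m - y ^+ m) by ring.
have x2 : `|x| <= 1 / 2 by lra.
have y2 : `|y| <= 1 / 2 by lra.
have H1 := normXB_le m.+1 x2 y2; have H2 := normXB_le m x2 y2.
apply: le_trans (ler_normD _ _) _; rewrite (normrM (4 * A)).
rewrite (@ger0_norm _ (4 * A)); last by lra.
rewrite (normrM 4) (@ger0_norm _ 4); last by lra.
have H3 : 4 * A * `|x ^+ m.+1 - y ^+ m.+1| <= 4 * A * `|x - y|.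
  by rewrite ler_wpM2l //; lra.
by have := normr_ge0 (x - y); nra.
Qed.

Lemma evenV_root (R : realFieldType) (m : nat) (a : int) (A : R) (x : R) :
    a%:~R = A -> 128 <= A -> `|x| <= 4 / A -> x != 0 ->
    (map_poly intr (trinom m a)).[x] = 0 ->
  (map_poly intr (evenV m a)).[x] != 0 /\
  `|(map_poly intr (evenV m a)).[x]| <= 8 * `|x| ^+ (2 * m + 2).
Proof.
move=> aA A128; have r8 := four_div_le A128 => xr x0.
rewrite horner_trinom horner_evenV aA => U0; clear aA.
have -> : 4 * (A * x ^+ m.+1 + x ^+ m) = - 4 * x ^+ (2 * m + 2).
  have -> : A * x ^+ m.+1 + x ^+ m = x ^+ m * (A * x + 1) by rewrite exprS; ring.
  have -> : A * x + 1 = - x ^+ m.+2 by lra.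
  suff -> : x ^+ (2 * m + 2) = x ^+ m * x ^+ m.+2 by ring.
  by rewrite -exprD; congr (_ ^+ _); lia.
rewrite mulf_neq0 ?expf_neq0 ?oppr_eq0 ?pnatr_eq0 //; split=> //.
have n4 : `|-4| = 4 :> R by rewrite normrN ger0_norm.
by rewrite normrM n4 normrX ler_wpM2r ?exprn_ge0 //; lra.
Qed.

Lemma oddU_slope (R : realFieldType) (m : nat) (a : int) (A : R) (x y : R) :
    a%:~R = A -> 128 <= A -> `|x| <= 4 / A -> `|y| <= 4 / A -> y <= x ->
  A / 2 * (x - y) <= (map_poly intr (oddU m a)).[x] - (map_poly intr (oddU m a)).[y].
Proof.
move=> aA A128; have r8 := four_div_le A128 => xr yr le_yx.
rewrite !horner_oddU aA; clear aA.
have x2 : `|x| <= 1 / 2 by lra.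
have y2 : `|y| <= 1 / 2 by lra.
have r2 : 4 / A <= 1 / 2 by lra.
have := normXB_le m.+1 x2 y2; have := normXB_le_small m r2 xr yr.
rewrite [`|x - y|]ger0_norm ?subr_ge0 //.
move=> /ler_normlP[H1 _] /ler_normlP[H2 _].
(* The large coefficient times the Lipschitz constant [8 / A] of the power stays bounded. *)
have Ar : (4 * A + 1) * (2 * (4 / A)) <= 33.
  have -> : (4 * A + 1) * (2 * (4 / A)) = 32 + 2 * (4 / A).
    by field; rewrite gt_eqF //; lra.
  by lra.
have xy0 : 0 <= x - y by rewrite subr_ge0.
have H3 : - (33 * (x - y)) <= (4 * A + 1) * (x ^+ m.+2 - y ^+ m.+2).
  rewrite lerNl -mulrN; apply: (@le_trans _ _ ((4 * A + 1) * (2 * (4 / A) * (x - y)))).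
    by rewrite ler_wpM2l //; lra.
  by rewrite (mulrA (4 * A + 1)) ler_wpM2r.
(* The loss 37 is 33 from the leading term plus 4 from [4 * x^(m+1)]. *)
suff : A / 2 * (x - y) <= A * (x - y) - 37 * (x - y) by lra.
by nra.
Qed.

Lemma trinom_lip (R : realFieldType) (m : nat) (a : int) (A : R) (x y : R) :
    a%:~R = A -> 128 <= A -> `|x| <= 4 / A -> `|y| <= 4 / A ->
  `|(map_poly intr (trinom m a)).[x] - (map_poly intr (trinom m a)).[y]|
    <= 8 * A * `|x - y|.
Proof.
move=> aA A128; have r8 := four_div_le A128 => xr yr.
rewrite !horner_trinom aA; clear aA.
have -> : x ^+ m.+2 + A * x + 1 - (y ^+ m.+2 + A * y + 1) =
  (x ^+ m.+2 - y ^+ m.+2) + A * (x - y) by ring.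
have x2 : `|x| <= 1 / 2 by lra.
have y2 : `|y| <= 1 / 2 by lra.
have H1 := normXB_le m.+2 x2 y2.
apply: le_trans (ler_normD _ _) _; rewrite normrM (@ger0_norm _ A); last by lra.
by have := normr_ge0 (x - y); nra.
Qed.

Lemma trinom_oddU_root (R : realFieldType) (m : nat) (a : int) (A : R) (x : R) :
    a%:~R = A -> 128 <= A -> `|x| <= 4 / A -> x != 0 ->
    (map_poly intr (oddU m a)).[x] = 0 ->
  (map_poly intr (trinom m a)).[x] != 0 /\
  `|(map_poly intr (trinom m a)).[x]| <= 8 * `|x| ^+ (2 * m + 3).
Proof.
move=> aA A128; have r8 := four_div_le A128 => xr x0.
rewrite horner_oddU horner_trinom aA => U0; clear aA.
set w := _ + 1.
have Ew : (4 * x ^+ m.+1 + 1) * w = 4 * x ^+ (2 * m + 3).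
  have -> : x ^+ (2 * m + 3) = x ^+ m.+1 * x ^+ m.+2 by rewrite -exprD; congr (_ ^+ _); lia.
  rewrite -[RHS]add0r -U0 /w; rewrite (exprS x m.+1); ring.
have x1 : `|x ^+ m.+1| <= 1 / 32.
  rewrite normrX exprS; apply: le_trans (r8); apply: le_trans (xr).
  by rewrite ler_piMr // exprn_ile1 //; lra.
have [xm1 xm2] : - (1 / 32) <= x ^+ m.+1 /\ x ^+ m.+1 <= 1 / 32.
  by apply/andP; rewrite -ler_norml.
split.
  apply: contra_eq_neq Ew => ->.
  by rewrite mulr0 eq_sym mulf_neq0 ?pnatr_eq0 ?expf_neq0.
have : `|4 * x ^+ m.+1 + 1| * `|w| = 4 * `|x| ^+ (2 * m + 3).
  by rewrite -normrM Ew normrM normrX ger0_norm.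
(* The factor [4 * x^(m+1) + 1] is at least [7 / 8], so dividing by it turns the constant 4 into at
   most 8. *)
rewrite ger0_norm; last by lra.
have := normr_ge0 w; nra.
Qed.

(** * Height, separation and irreducibility *)

(** For such polynomials the sum of the absolute values of the coefficients is the value at 1, from
    which both Perron's condition and a bound on the height are read off. *)
Definition nneg_coef (p : {poly int}) : Prop := forall i, 0 <= p`_i.

Lemma nneg_coefD (p q : {poly int}) :
  nneg_coef p -> nneg_coef q -> nneg_coef (p + q).
Proof. by move=> p0 q0 i; rewrite coefD addr_ge0. Qed.

Lemma nneg_coefM (p q : {poly int}) :
  nneg_coef p -> nneg_coef q -> nneg_coef (p * q).
Proof. by move=> p0 q0 i; rewrite coefM sumr_ge0 // => j _; rewrite mulr_ge0. Qed.

Lemma nneg_coefXn (n : nat) : nneg_coef 'X^n.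
Proof. by move=> i; rewrite coefXn. Qed.

Lemma nneg_coefX : nneg_coef 'X.
Proof. by move=> i; rewrite coefX. Qed.

Lemma nneg_coefC (c : int) : 0 <= c -> nneg_coef c%:P.
Proof. by move=> c0 i; rewrite coefC; case: eqP. Qed.

Lemma horner1_sum (P : {poly int}) : P.[1] = \sum_(i < size P) P`_i.
Proof. by rewrite horner_coef; apply: eq_bigr => i _; rewrite expr1n mulr1. Qed.

Lemma perron_nneg (d : nat) (P : {poly int}) :
    P \is monic -> size P = d.+2 -> P`_0 != 0 -> nneg_coef P ->
    P.[1] < 2 * P`_d ->
  irreducible_poly (map_poly intr P : {poly rat}).
Proof.
move=> mP szP P0 Pnn; rewrite horner1_sum szP !big_ord_recr /=.
have -> : P`_d.+1 = 1 by move/monicP: mP; rewrite lead_coefE szP.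
move=> lt1; apply: (perron_irreducible mP szP P0).
rewrite (ger0_norm (Pnn _)).
under eq_bigr do rewrite (ger0_norm (Pnn _)).
lra.
Qed.

Lemma height_ge_coef (P : {poly int}) (i : nat) :
  (i < size P)%N -> P`_i <= (height P)%:Z.
Proof.
move=> iP; apply: le_trans (ler_norm _) _; rewrite -abszE lez_nat.
exact: (leq_bigmax (Ordinal iP) (F := fun i : 'I_(size P) => absz P`_i)).
Qed.

Lemma height_le_horner1 (P : {poly int}) :
  nneg_coef P -> (height P)%:Z <= P.[1].
Proof.
move=> Pnn; have P1 : 0 <= P.[1].
  by rewrite horner1_sum; apply: sumr_ge0 => i _; exact: Pnn.
rewrite -(gez0_abs P1) lez_nat; apply/bigmax_leqP => i _.
rewrite -lez_nat (gez0_abs (Pnn i)) (gez0_abs P1) horner1_sum.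
rewrite (bigD1 i) //= lerDl; apply: sumr_ge0 => j _; exact: Pnn.
Qed.

(** Were the gcd of [p] and [p'] not constant, it would be associated to [p], which would then
    divide the nonzero polynomial [p'] of smaller degree. *)
Lemma irreducible_separable_rat (p : {poly rat}) : irreducible_poly p -> separable_poly p.
Proof.
move=> [sp irr]; rewrite unlock /coprimep; apply/eqP.
have dg : gcdp p p^`() %| p := dvdp_gcdl _ _.
have p0 : p != 0 by rewrite -size_poly_gt0 ltnW.
have szp' : size p^`() = (size p).-1 by rewrite size_deriv.
apply: contraTeq sp => /irr/(_ dg) pg.
have : p %| p^`() by rewrite -(eqp_dvdl _ pg) dvdp_gcdr.
move/dvdp_leq; rewrite -size_poly_gt0 szp'.
by case: (size p) => [|[|n]] //= /(_ isT); rewrite ltnn.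
Qed.

Lemma sep_gt0 (R : realType) (P : {poly int}) :
    irreducible_poly (map_poly intr P : {poly rat}) -> (2 < size P)%N ->
  0 < sep R P.
Proof.
move=> /irreducible_separable_rat sP szP.
have [[z [w [_ _ zw ->]]] _] := sep_min R sP szP.
rewrite lt_neqAle; apply/andP; split.
  by rewrite eq_sym; apply: contra zw => /eqP/eq0_normc/eqP; rewrite subr_eq0.
by case: (z - w) => a b /=; exact: sqrtr_ge0.
Qed.

Lemma sep_le_real (R : realType) (P : {poly int}) (x y : R) :
    irreducible_poly (map_poly intr P : {poly rat}) -> (2 < size P)%N ->
    root (map_poly intr P) x -> root (map_poly intr P) y -> x < y ->
  sep R P <= y - x.
Proof.
move=> /irreducible_separable_rat sP szP xr yr xy.
have [_ /(_ y%:C x%:C)] := sep_min R sP szP.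
have toC (z : R) : root (map_poly intr P) z -> croot P z%:C.
  move=> zr; rewrite /croot.
  have -> : map_poly intr P = map_poly (real_complex R) (map_poly intr P).
    by rewrite -map_poly_comp; apply: eq_map_poly => k /=; rewrite rmorph_int.
  by rewrite fmorph_root.
move=> /(_ (toC _ yr) (toC _ xr)).
have -> : normc (y%:C - x%:C) = y - x.
  by rewrite -rmorphB /normc /= expr0n addr0 sqrtr_sqr gtr0_norm ?subr_gt0.
by apply; apply: contraTneq xy => -[->]; rewrite ltxx.
Qed.

(** Common to both parities, in degree [e + 2]. A second coefficient of at least [16 * b^4] against
    [P(1) < 32 * b^4] gives Perron's condition, and the same two bounds enclose the height. *)
Lemma close_pair_family (R : realType) (e b : nat) (U V : {poly int}) :
    (2 ^ (e + 7) <= b)%N ->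
    nneg_coef U -> nneg_coef V -> U.[0] = 1 ->
    U ^+ 2 + 'X * V ^+ 2 \is monic -> size (U ^+ 2 + 'X * V ^+ 2) = e.+3 ->
    16 * b%:Z ^+ 4 <= (U ^+ 2 + 'X * V ^+ 2)`_e.+1 ->
    (U.[1] ^+ 2 + V.[1] ^+ 2 < 32 * b%:Z ^+ 4) ->
    (forall x y : R, `|x| <= 4 / b%:R ^+ 2 -> `|y| <= 4 / b%:R ^+ 2 -> y <= x ->
      b%:R ^+ 2 / 2 * (x - y) <= (map_poly intr U).[x] - (map_poly intr U).[y]) ->
    (forall x y : R, `|x| <= 4 / b%:R ^+ 2 -> `|y| <= 4 / b%:R ^+ 2 ->
      `|(map_poly intr V).[x] - (map_poly intr V).[y]| <= 8 * b%:R ^+ 2 * `|x - y|) ->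
    (forall x : R, `|x| <= 4 / b%:R ^+ 2 -> x != 0 -> (map_poly intr U).[x] = 0 ->
      (map_poly intr V).[x] != 0 /\ `|(map_poly intr V).[x]| <= 8 * `|x| ^+ e) ->
  exists P, [/\ monic_irreducible e.+2 P, (b ^ 4 <= height P)%N,
    (height P <= 32 * b ^ 4)%N, 0 < sep R P &
    sep R P <= 2 ^+ (e + 7) / b%:R ^+ (2 * e + 3)].
Proof.
move=> be Unn Vnn U0; set P := U ^+ 2 + 'X * V ^+ 2.
move=> mP szP Pe P1 slopeU lipV Vroot.
have Pnn : nneg_coef P.
  by apply: nneg_coefD; apply: nneg_coefM => //; [exact: nneg_coefX|exact: nneg_coefM].
have P1E : P.[1] = U.[1] ^+ 2 + V.[1] ^+ 2.
  by rewrite /P hornerD horner_exp hornerM horner_exp hornerX mul1r.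
have P00 : P`_0 != 0.
  by rewrite -horner_coef0 /P hornerD horner_exp hornerM hornerX mul0r U0 addr0 expr1n.
have irrP : irreducible_poly (map_poly intr P : {poly rat}).
  apply: (perron_nneg mP szP P00 Pnn); rewrite P1E; apply: lt_le_trans P1 _.
  by move: Pe; move: (b%:Z ^+ 4) (P`_e.+1); clear; lia.
have s2 : (2 < size P)%N by rewrite szP.
have b4 : 0 <= b%:Z ^+ 4 by rewrite exprn_ge0.
have [||x [y [xr yr xy yx]]] :=
  @close_roots R e b%:R (map_poly intr U) (map_poly intr V) _ _ slopeU lipV Vroot.
- by rewrite -natrX ler_nat.
- by rewrite -(rmorph0 intr) horner_map /= U0.
have mapP : map_poly intr U ^+ 2 + 'X * map_poly intr V ^+ 2 = map_poly intr P :> {poly R}.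
  by rewrite /P rmorphD rmorphXn rmorphM rmorphXn /= map_polyX.
rewrite mapP in xr yr.
exists P; split=> //.
- have : P`_e.+1 <= (height P)%:Z by apply: height_ge_coef; rewrite szP.
  rewrite -lez_nat -[((b ^ 4)%N)%:Z]natz natrX natz.
  by move: Pe b4; move: (b%:Z ^+ 4) (P`_e.+1) (height P); clear; lia.
- have := height_le_horner1 Pnn; rewrite P1E => hP.
  rewrite -lez_nat PoszM -[((b ^ 4)%N)%:Z]natz natrX natz.
  exact: le_trans hP (ltW P1).
- exact: sep_gt0.
by apply: le_trans yx; apply: sep_le_real.
Qed.

(** * Degrees, leading coefficients and signs for [trinom], [evenV] and [oddU] *)

Lemma size_CXnD (c : int) (n : nat) (q : {poly int}) :
  c != 0 -> (size q <= n)%N -> size (c%:P * 'X^n + q) = n.+1.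
Proof.
move=> c0 sq; have s1 : size (c%:P * 'X^n) = n.+1.
  by rewrite mul_polyC size_scale // size_polyXn.
by rewrite size_polyDl s1.
Qed.

Lemma lead_coef_CXnD (c : int) (n : nat) (q : {poly int}) :
  c != 0 -> (size q <= n)%N -> lead_coef (c%:P * 'X^n + q) = c.
Proof.
move=> c0 sq; rewrite lead_coefE size_CXnD //= coefD coefCM coefXn eqxx mulr1.
by rewrite nth_default // addr0.
Qed.

Lemma size_sqr (p : {poly int}) (n : nat) : size p = n.+1 -> size (p ^+ 2) = (2 * n).+1.
Proof.
move=> sp; have p0 : p != 0 by rewrite -size_poly_gt0 sp.
have := size_exp p 2; rewrite sp /= mulnC => <-.
by rewrite prednK // size_poly_gt0 expf_neq0.
Qed.

Lemma coef_sqr_top (p : {poly int}) (n : nat) :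
  size p = n.+1 -> (p ^+ 2)`_(2 * n) = lead_coef p ^+ 2.
Proof. by move=> sp; rewrite -lead_coef_exp lead_coefE (size_sqr sp). Qed.

Lemma size_CXD1 (a : int) : (size (a%:P * 'X + 1)%R <= 2)%N.
Proof.
rewrite (leq_trans (size_polyD _ _)) // geq_max size_poly1 andbT.
by rewrite mul_polyC (leq_trans (size_scale_leq _ _)) ?size_polyX.
Qed.

Lemma trinomE (m : nat) (a : int) : trinom m a = 1%:P * 'X^(m.+2) + (a%:P * 'X + 1).
Proof. by rewrite mul1r addrA. Qed.

Lemma size_trinom (m : nat) (a : int) : size (trinom m a) = m.+3.
Proof. by rewrite trinomE size_CXnD // (leq_trans (size_CXD1 a)). Qed.

Lemma monic_trinom (m : nat) (a : int) : trinom m a \is monic.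
Proof. by rewrite monicE trinomE lead_coef_CXnD // (leq_trans (size_CXD1 a)). Qed.

Lemma size_CXn_le (c : int) (n : nat) : (size (c%:P * 'X^n : {poly int})%R <= n.+1)%N.
Proof. by rewrite mul_polyC (leq_trans (size_scale_leq _ _)) ?size_polyXn. Qed.

Lemma size_evenV (m : nat) (a : int) : a != 0 -> size (evenV m a) = m.+2.
Proof. by move=> a0; rewrite size_CXnD ?mulf_neq0 // size_CXn_le. Qed.

Lemma lead_coef_evenV (m : nat) (a : int) : a != 0 -> lead_coef (evenV m a) = 4 * a.
Proof. by move=> a0; rewrite lead_coef_CXnD ?mulf_neq0 // size_CXn_le. Qed.

Lemma oddUE (m : nat) (a : int) :
  oddU m a = (4 * a + 1)%:P * 'X^(m.+2) + (4%:P * 'X^(m.+1) + (a%:P * 'X + 1)).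
Proof. by rewrite /oddU !addrA. Qed.

Lemma size_oddU_tail (m : nat) (a : int) :
  (size (4%:P * 'X^(m.+1) + (a%:P * 'X + 1) : {poly int})%R <= m.+2)%N.
Proof.
rewrite (leq_trans (size_polyD _ _)) // geq_max size_CXn_le.
exact: leq_trans (size_CXD1 a) _.
Qed.

Lemma size_oddU (m : nat) (a : int) : 0 <= a -> size (oddU m a) = m.+3.
Proof. by move=> a0; rewrite oddUE size_CXnD ?size_oddU_tail //; lia. Qed.

Lemma lead_coef_oddU (m : nat) (a : int) : 0 <= a -> lead_coef (oddU m a) = 4 * a + 1.
Proof. by move=> a0; rewrite oddUE lead_coef_CXnD ?size_oddU_tail //; lia. Qed.

Lemma nneg_coef_CXn (c : int) (n : nat) : 0 <= c -> nneg_coef (c%:P * 'X^n).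
Proof.
by move=> c0; apply: nneg_coefM; [exact: nneg_coefC|exact: nneg_coefXn].
Qed.

Lemma nneg_coef_trinom (m : nat) (a : int) : 0 <= a -> nneg_coef (trinom m a).
Proof.
move=> a0; apply: nneg_coefD; last exact: nneg_coefC.
apply: nneg_coefD; first exact: nneg_coefXn.
exact: nneg_coef_CXn 1%N a0.
Qed.

Lemma nneg_coef_evenV (m : nat) (a : int) : 0 <= a -> nneg_coef (evenV m a).
Proof. by move=> a0; apply: nneg_coefD; apply: nneg_coef_CXn => //; lia. Qed.

Lemma nneg_coef_oddU (m : nat) (a : int) : 0 <= a -> nneg_coef (oddU m a).
Proof.
move=> a0; apply: nneg_coefD; last exact: nneg_coefC.
apply: nneg_coefD; last exact: nneg_coef_CXn 1%N a0.
by apply: nneg_coefD; apply: nneg_coef_CXn => //; lia.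
Qed.

(** * Values at 1, and close roots in even and in odd degree *)

Lemma horner_int (p : {poly int}) (x : int) : p.[x] = (map_poly intr p).[x].
Proof. by rewrite map_poly_id // => k _; rewrite intz. Qed.

(** The left side is [U(1)^2 + V(1)^2]. Its leading constant is 17 here and 26 in the odd case, both
    below the 32 that Perron's condition allows. *)
Lemma horner1_bound_even (a : int) :
  128 <= a -> (1 + a + 1) ^+ 2 + (4 * (a + 1)) ^+ 2 < 32 * a ^+ 2.
Proof.
move=> a128; have sq : 128 * a <= a ^+ 2 by rewrite expr2 ler_wpM2r //; lia.
have -> : (1 + a + 1) ^+ 2 + (4 * (a + 1)) ^+ 2 = 17 * a ^+ 2 + 36 * a + 20 by ring.
by lra.
Qed.

Lemma horner1_bound_odd (a : int) : 128 <= a ->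
  (4 * a + 1 + 4 + a + 1) ^+ 2 + (1 + a + 1) ^+ 2 < 32 * a ^+ 2.
Proof.
move=> a128; have sq : 128 * a <= a ^+ 2 by rewrite expr2 ler_wpM2r //; lia.
have -> : (4 * a + 1 + 4 + a + 1) ^+ 2 + (1 + a + 1) ^+ 2 = 26 * a ^+ 2 + 64 * a + 40.
  by ring.
by lra.
Qed.

Lemma close_pair_even (R : realType) (m b : nat) : (2 ^ (2 * m + 2 + 7) <= b)%N ->
  exists P, [/\ monic_irreducible (2 * m + 2).+2 P, (b ^ 4 <= height P)%N,
    (height P <= 32 * b ^ 4)%N, 0 < sep R P &
    sep R P <= 2 ^+ (2 * m + 2 + 7) / b%:R ^+ (2 * (2 * m + 2) + 3)].
Proof.
move=> hb; pose a : int := b%:Z ^+ 2.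
have b128 : (128 <= b)%N.
  by apply: leq_trans hb; rewrite -[128%N]/(2 ^ 7)%N leq_exp2l // leq_addl.
have a128 : 128 <= a by rewrite /a; nia.
have a0 : 0 <= a by lia.
have an0 : a != 0 by lia.
have aA : a%:~R = b%:R ^+ 2 :> R by rewrite rmorphXn.
have A128 : 128 <= b%:R ^+ 2 :> R by rewrite -aA -[128]/(128%:~R) ler_int.
have b4 : b%:Z ^+ 4 = a ^+ 2 by rewrite -exprM.
have sV : size ('X * evenV m a ^+ 2) = (2 * m + 4)%N.
  rewrite mulrC size_mulX ?(size_sqr (size_evenV m an0)); last first.
    by rewrite expf_neq0 // -size_poly_gt0 size_evenV.
  lia.
have sU : size (trinom m a ^+ 2) = (2 * m + 5)%N.
  by rewrite (size_sqr (size_trinom m a)); lia.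
apply: (@close_pair_family R _ b (trinom m a) (evenV m a)) => //.
- exact: nneg_coef_trinom.
- exact: nneg_coef_evenV.
- by rewrite horner_int horner_trinom expr0n mulr0 !add0r.
- rewrite monicE lead_coefDl ?sU ?sV ?lead_coef_exp; last by lia.
  by rewrite (monicP (monic_trinom m a)) expr1n.
- by rewrite size_polyDl ?sU ?sV; lia.
(* The factor ['X] shifts the top coefficient [16 * a^2] of [evenV^2] to second position in the sum;
   [trinom^2] only adds to it. *)
- rewrite coefD coefXM /= b4.
  have -> : (2 * m + 2 = 2 * m.+1)%N by lia.
  rewrite (coef_sqr_top (size_evenV m an0)) lead_coef_evenV //.
  have -> : (4 * a) ^+ 2 = 16 * a ^+ 2 by ring.
  by rewrite lerDr; apply: nneg_coefM; exact: nneg_coef_trinom.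
- rewrite (horner_int (trinom m a)) (horner_int (evenV m a)).
  rewrite horner_trinom horner_evenV !expr1n b4 !intz !mulr1.
  exact: horner1_bound_even.
- by move=> x y; exact: trinom_slope.
- by move=> x y; exact: evenV_lip.
- by move=> x; exact: evenV_root.
Qed.

Lemma close_pair_odd (R : realType) (m b : nat) : (2 ^ (2 * m + 3 + 7) <= b)%N ->
  exists P, [/\ monic_irreducible (2 * m + 3).+2 P, (b ^ 4 <= height P)%N,
    (height P <= 32 * b ^ 4)%N, 0 < sep R P &
    sep R P <= 2 ^+ (2 * m + 3 + 7) / b%:R ^+ (2 * (2 * m + 3) + 3)].
Proof.
move=> hb; pose a : int := b%:Z ^+ 2.
have b128 : (128 <= b)%N.
  by apply: leq_trans hb; rewrite -[128%N]/(2 ^ 7)%N leq_exp2l // leq_addl.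
have a128 : 128 <= a by rewrite /a; nia.
have a0 : 0 <= a by lia.
have aA : a%:~R = b%:R ^+ 2 :> R by rewrite rmorphXn.
have A128 : 128 <= b%:R ^+ 2 :> R by rewrite -aA -[128]/(128%:~R) ler_int.
have b4 : b%:Z ^+ 4 = a ^+ 2 by rewrite -exprM.
have sV : size ('X * trinom m a ^+ 2) = (2 * m + 6)%N.
  rewrite mulrC size_mulX ?(size_sqr (size_trinom m a)); last first.
    by rewrite expf_neq0 // -size_poly_gt0 size_trinom.
  lia.
have sU : size (oddU m a ^+ 2) = (2 * m + 5)%N.
  by rewrite (size_sqr (size_oddU m a0)); lia.
apply: (@close_pair_family R _ b (oddU m a) (trinom m a)) => //.
- exact: nneg_coef_oddU.
- exact: nneg_coef_trinom.
- by rewrite horner_int horner_oddU !expr0n !mulr0 !add0r.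
(* In odd degree the leading term comes from ['X * trinom^2], and the second coefficient mainly from
   the square of [oddU]. *)
- rewrite monicE lead_coefDr ?sU ?sV; last by lia.
  by rewrite lead_coefM lead_coefX lead_coef_exp (monicP (monic_trinom m a)) expr1n.
- by rewrite addrC size_polyDl ?sU ?sV; lia.
- rewrite coefD coefXM /= b4.
  have -> : ((2 * m + 3).+1 = 2 * m.+2)%N by lia.
  rewrite (coef_sqr_top (size_oddU m a0)) lead_coef_oddU //.
  have -> : (4 * a + 1) ^+ 2 = 16 * a ^+ 2 + (8 * a + 1) by ring.
  rewrite -addrA lerDl; apply: addr_ge0; first by rewrite addr_ge0 ?mulr_ge0.
  by apply: nneg_coefM; exact: nneg_coef_trinom.
- rewrite (horner_int (trinom m a)) (horner_int (oddU m a)).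
  rewrite horner_trinom horner_oddU !expr1n b4 !intz !mulr1.
  exact: horner1_bound_odd.
- by move=> x y; exact: oddU_slope.
- by move=> x y; exact: trinom_lip.
- by move=> x; exact: trinom_oddU_root.
Qed.

Lemma close_pair (R : realType) (d b : nat) : (4 <= d)%N -> (2 ^ (d + 5) <= b)%N ->
  exists P, [/\ monic_irreducible d P, (b ^ 4 <= height P)%N,
    (height P <= 32 * b ^ 4)%N, 0 < sep R P &
    sep R P <= 2 ^+ (d + 5) / b%:R ^+ (2 * d - 1)].
Proof.
move=> d4 hb.
case: (boolP (odd d)) => od.
  (* With [e = d - 2], the exponents [e + 7] and [2 * e + 3] become [d + 5] and [2 * d - 1]. *)
  have [m dE] : exists m, d = (2 * m + 3).+2 by exists (d./2 - 2)%N; lia.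
  have hb' : (2 ^ (2 * m + 3 + 7) <= b)%N by rewrite (leq_trans _ hb) // dE leq_exp2l //; lia.
  have [P] := close_pair_odd R hb'; exists P; rewrite dE.
  by have [-> ->] : ((2 * m + 3).+2 + 5 = 2 * m + 3 + 7 /\
    2 * (2 * m + 3).+2 - 1 = 2 * (2 * m + 3) + 3)%N by lia.
have [m dE] : exists m, d = (2 * m + 2).+2 by exists (d./2 - 2)%N; lia.
have hb' : (2 ^ (2 * m + 2 + 7) <= b)%N by rewrite (leq_trans _ hb) // dE leq_exp2l //; lia.
have [P] := close_pair_even R hb'; exists P; rewrite dE.
by have [-> ->] : ((2 * m + 2).+2 + 5 = 2 * m + 2 + 7 /\
  2 * (2 * m + 2).+2 - 1 = 2 * (2 * m + 2) + 3)%N by lia.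
Qed.

(** * The separation exponent *)

(** Put [q = d/2 - 1/4], so that [2 * d - 1 = 4 * q], and [L = ln b]. Then [- ln sep] is at least
    [4 * q * L - (d + 5) * ln 2], while [ln H] lies between [4 * L] and [4 * L + ln 32]. The last
    hypothesis says that [eps] absorbs the constants. *)
Lemma sep_exponent_ge (R : realType) (d b : nat) (P : {poly int}) (eps : R) :
    (4 <= d)%N -> (1 < b)%N -> 0 < eps ->
    (b ^ 4 <= height P)%N -> (height P <= 32 * b ^ 4)%N -> 0 < sep R P ->
    sep R P <= 2 ^+ (d + 5) / b%:R ^+ (2 * d - 1) ->
    (d%:R / 2 - 1 / 4) * ln 32 + (d + 5)%:R * ln 2 <= 4 * eps * ln b%:R ->
  d%:R / 2 - 1 / 4 <= sep_exponent R P + eps.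
Proof.
move=> d4 b1 eps0 Hge Hle sep0 sepb big.
have dE : (2 * d - 1)%:R = 4 * (d%:R / 2 - 1 / 4) :> R.
  by rewrite natrB ?muln_gt0 ?(leq_trans _ d4) // natrM; clear; field.
have b0 : 0 < b%:R :> R by rewrite ltr0n ltnW.
have L0 : 0 < ln (b%:R : R) by rewrite ln_gt0 // ltr1n.
have H0 : 0 < (height P)%:R :> R.
  by rewrite ltr0n (leq_trans _ Hge) // expn_gt0 ltnW.
have lnH1 : 4 * ln (b%:R : R) <= ln (height P)%:R.
  rewrite mulr_natl -lnXn // ler_ln ?posrE ?exprn_gt0 //.
  by rewrite -natrX ler_nat.
have lnH2 : ln (height P)%:R <= ln (32 : R) + 4 * ln b%:R.
  rewrite mulr_natl -lnXn // -lnM ?posrE ?exprn_gt0 // ler_ln ?posrE //; last first.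
    by rewrite mulr_gt0 ?exprn_gt0.
  by rewrite -natrX -natrM ler_nat.
have lnS : ln (sep R P) <= (d + 5)%:R * ln 2 - (2 * d - 1)%:R * ln b%:R.
  rewrite !mulr_natl -!lnXn // -ln_div ?posrE ?exprn_gt0 // ler_ln ?posrE //.
  by rewrite divr_gt0 ?exprn_gt0.
have lnH0 : 0 < ln ((height P)%:R : R) by rewrite (lt_le_trans _ lnH1) // mulr_gt0.
rewrite -lerBlDr /sep_exponent ler_pdivlMr //.
have e0 : 0 <= d%:R / 2 - 1 / 4 :> R.
  by have : 4 <= d%:R :> R by [rewrite ler_nat]; lra.
rewrite dE in lnS; set q := _ - 1 / 4 in big e0 lnS *.
have H1 := ler_wpM2l e0 lnH2; have H2 := ler_wpM2l (ltW eps0) lnH1.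
by move: H1 H2 big lnS; clear; lra.
Qed.

Lemma log_nat_unbounded (R : realType) (x : R) (N : nat) :
  exists2 b : nat, (N <= b)%N & x <= ln b%:R.
Proof.
have [n xn] : exists n : nat, expR x < n%:R.
  by exists (Num.bound (expR x)); apply: archi_boundP; exact: expR_ge0.
exists (maxn N n); first exact: leq_maxl.
have n0 : 0 < (maxn N n)%:R :> R.
  by rewrite (lt_le_trans (expR_gt0 x)) // (le_trans (ltW xn)) // ler_nat leq_maxr.
rewrite -ler_expR lnK ?posrE //.
by rewrite (le_trans (ltW xn)) // ler_nat leq_maxr.
Qed.

Theorem theorem3 (R : realType) (d : nat) (hd : (4 <= d)%N) :
  ((d%:R / 2 - 1 / 4)%:E <= e_irr_star R d)%E.
Proof.
(* The limsup is an infimum over [N] of suprema, so each supremum is bounded, up to an arbitrary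
   [eps]. *)
apply: le_ereal_inf_tmp => _ [N _ <-].
apply/lee_addgt0Pr => eps eps0.
pose K : R := (d%:R / 2 - 1 / 4) * ln 32 + (d + 5)%:R * ln 2.
(* Three demands on [b]: height at least [N], the threshold of [close_pair], and a logarithm large
   enough for the error to be at most [eps]. *)
have [b bN Kb] := log_nat_unbounded (K / (4 * eps)) (maxn N (2 ^ (d + 5))).
have bN1 : (N <= b)%N := leq_trans (leq_maxl _ _) bN.
have b2 : (2 ^ (d + 5) <= b)%N := leq_trans (leq_maxr _ _) bN.
have b1 : (1 < b)%N by rewrite (leq_trans _ b2) // -[2%N]expn1 leq_exp2l //; lia.
have [P [mP Hge Hle sep0 sepb]] := close_pair R hd b2.
have big : K <= 4 * eps * ln b%:R by rewrite mulrC -ler_pdivrMr // mulr_gt0.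
have leP := sep_exponent_ge hd b1 eps0 Hge Hle sep0 sepb big.
apply: le_trans (_ : (sep_exponent R P)%:E + eps%:E <= _)%E; first by rewrite -EFinD lee_fin.
rewrite leeD2r //; apply: ereal_sup_ubound; exists P => //; split=> //.
by rewrite (leq_trans bN1) // (leq_trans _ Hge) // -{1}[b]expn1 leq_exp2l.
Qed.
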